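(* Let $\mathbb{F}_q$ be a finite field, let $R=(r_1,r_2,\dots,r_m)\in\mathbb{Z}_+^m$ be a tuple of positive integers with $r=\sum_{i=1}^m r_i$, and let $p(s)\in\mathbb{F}_q[s]$ be a primitive polynomial of degree $n$. Then the number of multisequences $W$ in $\mathbb{F}_q^m$ (counted up to shift) with minimal polynomial $p(s)$ whose $R$-extensions $W_R$ have dimension $r$ is equal to $$(q^n-q^{r-m+1})(q^n-q^{r-m+2})\cdots(q^n-q^{r-1}).$$
   Context: A multisequence in $\mathbb{F}_q^m$ is a map $W:\mathbb{Z}\to\mathbb{F}_q^m$, with values regarded as column vectors; its component sequences $W_1,\dots,W_m:\mathbb{Z}\to\mathbb{F}_q$ are its coordinates. All multisequences considered are periodic. A monic polynomial $s^d-a_{d-1}s^{d-1}-\cdots-a_0\in\mathbb{F}_q[s]$ is associated with the linear recurring relation $W(k+d)=a_{d-1}W(k+d-1)+\cdots+a_0W(k)$ for all $k\in\mathbb{Z}$. The polynomials associated with the relations satisfied by $W$ form an ideal of $\mathbb{F}_q[s]$, whose monic generator is the minimal polynomial of $W$. If the minimal polynomial has degree $n$, the matrix states of $W$ are the $m\times n$ matrices $M_W(k)=[W(k),W(k+1),\dots,W(k+n-1)]$, $k\in\mathbb{Z}$; they all have the same column span, and the dimension of $W$ is the common rank of its matrix states. The shift $\sigma$ is defined by $(\sigma S)(k)=S(k+1)$. Two multisequences are considered the same (counted once) if one is a shift $\sigma^\ell W$, $\ell\in\mathbb{Z}$, of the other. For $R=(r_1,\dots,r_m)\in\mathbb{Z}_+^m$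 ($\mathbb{Z}_+$ denotes the positive integers) with $\sum r_i=r$, the $R$-extension $W_R$ of a multisequence $W$ in $\mathbb{F}_q^m$ is the multisequence in $\mathbb{F}_q^r$ whose component sequences are, in order, $W_1,\sigma W_1,\dots,\sigma^{r_1-1}W_1,\;W_2,\sigma W_2,\dots,\sigma^{r_2-1}W_2,\;\dots,\;W_m,\sigma W_m,\dots,\sigma^{r_m-1}W_m$. It has the same minimal polynomial as $W$. A primitive polynomial of degree $n$ over $\mathbb{F}_q$ is the minimal polynomial over $\mathbb{F}_q$ of a generator of the multiplicative group $\mathbb{F}_{q^n}^*$.
   Formalization: The formal theorem adds the hypothesis r < n + m; for r ≥ n + m the stated formula is false, since no R-extension can have dimension r > n (the count is 0) while the product is nonzero, e.g. m = 1, r = n + 1. *)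

(* Defs.v *)
From HB Require Import structures.
From mathcomp Require Import all_boot all_order all_fingroup all_algebra.
From mathcomp Require Import all_solvable all_field.

Set Implicit Arguments.
Unset Strict Implicit.
Unset Printing Implicit Defensive.

Import Order.TTheory GRing.Theory Num.Theory.

Local Open Scope ring_scope.

(* L plays the role of F_{q^n}; finvect_type L is L with its finite field
   structure, so that {unit finvect_type L} is the finite group L^*.
   qfpoly.primitive_poly is a different, order-based, definition. *)
Definition primitive_poly_of_degree (F : finFieldType) (n : nat)
    (p : {poly F}) : Prop :=
  exists (L : fieldExtType F) (u : {unit finvect_type L}),
    [/\ \dim {:L} = n,
        generator [set: {unit finvect_type L}] u &
        map_poly (in_alg L) p = minPoly 1%AS (val u : L)].

(* Imported only now, since it redefines the notation for full sets. *)
From mathcomp Require Import boolp classical_sets functions cardinality.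

Local Open Scope classical_set_scope.
Local Open Scope ring_scope.

Definition multiseq (F : finFieldType) (m : nat) := int -> 'cV[F]_m.

Definition periodic (F : finFieldType) m (W : multiseq F m) : Prop :=
  exists2 T : nat, (0 < T)%N & forall k : int, W (k + T%:Z) = W k.

(* For monic f = s^d - a_(d-1) s^(d-1) - ... - a_0, a_i is - f`_i; the
   definition is only meaningful (and only used) for monic f. *)
Definition satisfies (F : finFieldType) m (W : multiseq F m)
    (f : {poly F}) : Prop :=
  forall k : int, W (k + (size f).-1%:Z) =
    \sum_(i < (size f).-1) (- f`_i) *: W (k + (i : nat)%:Z).

(* A polynomial ideal over a field is determined by its monic elements, so
   this says that p is the monic generator of the ideal of relations of W. *)
Definition is_min_poly (F : finFieldType) m (W : multiseq F m)
    (p : {poly F}) : Prop :=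
  p \is monic /\ (forall f, f \is monic -> (satisfies W f <-> p %| f)).

Definition matrix_state (F : finFieldType) m (W : multiseq F m) (n : nat)
    (k : int) : 'M[F]_(m, n) :=
  \matrix_(i < m, j < n) W (k + (j : nat)%:Z) i 0.

Definition has_dimension (F : finFieldType) m (W : multiseq F m)
    (d : nat) : Prop :=
  exists2 p : {poly F}, is_min_poly W p &
    forall k : int, \rank (matrix_state W (size p).-1 k) = d.

Definition shift (F : finFieldType) m (l : int) (W : multiseq F m) :
    multiseq F m :=
  fun k => W (k + l).

Definition shift_class (F : finFieldType) m (W : multiseq F m) :
    set (multiseq F m) :=
  [set V | exists l : int, V = shift l W].

Definition extension (F : finFieldType) m (R : 'I_m -> nat)
    (W : multiseq F m) : multiseq F (\sum_(i < m) R i) :=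
  fun k => \mxcol_(i < m) \col_(j < R i) W (k + (j : nat)%:Z) i 0.

Definition extension_classes (F : finFieldType) m (R : 'I_m -> nat)
    (p : {poly F}) : set (set (multiseq F m)) :=
  [set shift_class W | W in
    [set W : multiseq F m | [/\ periodic W, is_min_poly W p &
       has_dimension (extension R W) (\sum_(i < m) R i)]]].

(* Main.v *)
(** Write p as the minimal polynomial of a generator u of the unit group of
    L = F_(q^n), and let l be a nonzero F-linear form on L.  The multisequences
    annihilated by p are the W_w(k)_i = l(u^k w_i) with w in L^m; shifting
    multiplies w by a power of u, that is, by an arbitrary element of L^*, and
    W_R has dimension r iff w is "independent": the r elements u^j w_i, j < r_i,
    are linearly independent over F.  So one counts the independent w with a
    fixed coordinate equal to 1.

    For w in L^m let y(w) be the number of F-linear relations between the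
    u^j w_i, i.e. of tuples f of polynomials f_i of degree < r_i with
    sum_i f_i(u) w_i = 0.  Then sum_w y(w)^s counts the pairs of w and an
    s-tuple of relations of w, hence is the sum over s-tuples t of polynomial
    vectors of (q^n)^(m - rank t(u)).  The minors of t have degree at most r - m,
    so if r - m < n the rank of t(u) is the rank of t over F(X), which does not
    depend on n.  Interpolating the indicator function of y = 1, the number of
    independent w is therefore P(q^n) for one monic P of degree m independent of
    n.  It vanishes at q^i for r - m < i < r, as r elements of F_(q^i) cannot be
    independent, and at 1, where it formally counts the w over a field with one
    element, for which y = q^r.  Hence
    P = (X - 1) (X - q^(r-m+1)) ... (X - q^(r-1)). *)

From HB Require Import structures.
Require Import Defs.
From mathcomp Require Import all_boot all_order all_fingroup all_algebra.
From mathcomp Require Import all_solvable all_field all_character zify.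
From mathcomp Require boolp.

Set Implicit Arguments.
Unset Strict Implicit.
Unset Printing Implicit Defensive.

Import Order.TTheory GRing.Theory Num.Theory.

Local Open Scope ring_scope.

(** * The polynomial counting independent vectors *)

Lemma leq_rank_minor (K : fieldType) a b k (A : 'M[K]_(a, b))
    (f : 'I_k -> 'I_a) (g : 'I_k -> 'I_b) :
  \det (mxsub f g A) != 0 -> (k <= \rank A)%N.
Proof.
rewrite -unitfE => detU.
have : mxsub f g A \in unitmx by rewrite unitmxE.
rewrite -row_free_unit => /eqP <-.
rewrite mxsubrc (leq_trans (mxrankS (rowsub_sub _ _))) //.
rewrite -mxrank_tr (leq_trans _ (eq_leq (mxrank_tr A))) //.
by rewrite trmx_mxsub (mxrankS (rowsub_sub _ _)).
Qed.

(** Injectivity of [g] is recorded because the degree bound for a minor charges each chosen column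
    once. *)
Lemma rank_minor (K : fieldType) a b (A : 'M[K]_(a, b)) :
  exists (f : 'I_(\rank A) -> 'I_a) (g : 'I_(\rank A) -> 'I_b),
    injective g /\ \det (mxsub f g A) != 0.
Proof.
pose B := rowsub (maxrankfun A) A.
have fullB : row_full B^T by rewrite /row_full mxrank_tr; apply: maxrowsub_free.
have [g [g_inj gU]] : exists g : 'I_(\rank A) -> 'I_b,
    injective g /\ rowsub g B^T \in unitmx.
  exists (fullrankfun fullB); split; first exact: fullrankfun_inj.
  exact: fullrowsub_unit.
exists (maxrankfun A), g; split=> //.
rewrite -unitfE -unitmxE -unitmx_tr trmx_mxsub.
by move: gU; rewrite /B trmx_mxsub -mxsub_comp.
Qed.

(** Each Leibniz term takes one entry from every column, so column-wise degree bounds add up. *)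
Lemma size_det_leq (F : fieldType) k (A : 'M[{poly F}]_k) (d : 'I_k -> nat) :
  (forall i j, size (A i j) <= (d j).+1)%N ->
  (size (\det A) <= (\sum_j d j).+1)%N.
Proof.
move=> sizeA; apply: leq_trans (size_sum _ _ _) _.
apply/bigmax_leqP => s _; rewrite mulr_sign.
apply: (@leq_trans (size (\prod_i A i (s i)))).
  by case: ifP; rewrite ?size_polyN.
rewrite [X in (_ <= X.+1)%N](reindex_inj (@perm_inj _ s)) /=.
elim/big_ind2: _ => [|x m y n hx hy|i _]; first by rewrite size_poly1.
  apply: leq_trans (size_polyMleq _ _) _.
  by rewrite -subn1 leq_subLR add1n -addnS -addSn leq_add.
exact: sizeA.
Qed.

Section Counting.

Variables (F : finFieldType) (m : nat) (R : 'I_m -> nat).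
Hypothesis R_gt0 : forall i, (0 < R i)%N.

Local Notation r := (\sum_(i < m) R i)%N.
Local Notation V := 'rV[F]_r.

Definition coef_polys (v : V) : 'rV[{poly F}]_m := \row_i rVpoly (submxrow v i).

(** The bound is on the size: [ev] kills no nonzero polynomial of degree below [d], so
    [d = (r - m).+1] covers degrees up to [r - m]. *)
Definition injective_below (K : fieldType) (ev : {rmorphism {poly F} -> K})
    (d : nat) : Prop :=
  forall f : {poly F}, f != 0 -> (size f <= d)%N -> ev f != 0.

(** The blocks of [v] are the coefficients of the [f_i] in a relation. For [ev] the evaluation at
    [u], this is linear independence over [F] of the [u^j w_i] with [j < R i]. *)
Definition indep (K : fieldType) (ev : {rmorphism {poly F} -> K})
    (w : 'cV[K]_m) : bool :=
  [forall v : V, (map_mx ev (coef_polys v) *m w == 0) ==> (v == 0)].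

Definition tuple_mx s (t : {ffun 'I_s -> V}) : 'M[{poly F}]_(s, m) :=
  \matrix_(a, i) coef_polys (t a) 0 i.

Lemma size_coef_polys v i : (size (coef_polys v 0%R i) <= R i)%N.
Proof. by rewrite mxE /rVpoly size_poly. Qed.

(** A nonzero minor after [ev1] comes from a nonzero minor over [F[X]]. Its degree is at most the
    sum of all [R i - 1], which is [r - m], so [ev2] does not kill it either. *)
Lemma leq_rank_eval (K1 K2 : fieldType) (ev1 : {rmorphism {poly F} -> K1})
    (ev2 : {rmorphism {poly F} -> K2}) s (t : {ffun 'I_s -> V}) :
  injective_below ev2 (r - m).+1 ->
  (\rank (map_mx ev1 (tuple_mx t)) <= \rank (map_mx ev2 (tuple_mx t)))%N.
Proof.
move=> ev2P; have [f [g [g_inj]]] := rank_minor (map_mx ev1 (tuple_mx t)).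
rewrite -map_mxsub det_map_mx => nz.
apply: (@leq_rank_minor _ _ _ _ _ f g); rewrite -map_mxsub det_map_mx ev2P //.
  by apply: contra_neq nz => ->; rewrite rmorph0.
apply: leq_trans (size_det_leq (d := fun j => (R (g j)).-1) _) _.
  by move=> i j; rewrite prednK // mxE mxE size_coef_polys.
have -> : (r - m = \sum_i (R i).-1)%N.
  apply/eqP; rewrite -(eqn_add2r m) subnK; last first.
    by rewrite -[X in (X <= _)%N]card_ord -sum1_card leq_sum.
  rewrite -[X in (_ + X)%N]card_ord -sum1_card -big_split /=.
  by apply/eqP/eq_bigr => i _; rewrite addn1 prednK.
rewrite ltnS -(big_imset (fun i => (R i).-1) (in2W g_inj)) /=.
by rewrite [X in (_ <= X)%N](bigID [in g @: 'I__]) leq_addr.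
Qed.

Lemma coef_polys_eq0 v : coef_polys v = 0 -> v = 0.
Proof.
move=> v0; apply/mxrowP => i; rewrite submxrow0.
apply: (can_inj rVpolyK); rewrite linear0.
by have /rowP/(_ i) := v0; rewrite !mxE.
Qed.

Fact coef_polys_is_zmod_morphism : zmod_morphism coef_polys.
Proof.
by move=> v1 v2; apply/rowP => i; rewrite !mxE submxrowB linearB.
Qed.

HB.instance Definition _ :=
  GRing.isZmodMorphism.Build V 'rV[{poly F}]_m coef_polys
    coef_polys_is_zmod_morphism.

Lemma card_cV_ker (K : finFieldType) s (A : 'M[K]_(s, m)) :
  #|[set w : 'cV_m | A *m w == 0]| = (#|K| ^ (m - \rank A))%N.
Proof.
rewrite -[\rank A]mxrank_tr -mxrank_ker -card_rowg.
rewrite -(card_imset _ (@trmx_inj K m 1)); apply: eq_card => v.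
rewrite inE sub_kermx -[v]trmxK mem_imset; last exact: trmx_inj.
by rewrite inE -(inj_eq trmx_inj) trmx_mul trmx0 trmxK.
Qed.

Section Ker.

Variables (K : finFieldType) (ev : {rmorphism {poly F} -> K}).

Definition rels (w : 'cV[K]_m) : {set V} :=
  [set v | map_mx ev (coef_polys v) *m w == 0].

Lemma rels0 w : 0 \in rels w.
Proof. by rewrite inE raddf0 map_mx0 mul0mx. Qed.

Lemma indepE w : indep ev w = (#|rels w| == 1)%N.
Proof.
apply/forallP/idP => [wP|/cards1P[v relsE] v'].
  apply/cards1P; exists 0; apply/setP => v; rewrite in_set1.
  apply/idP/eqP => [|->]; last exact: rels0.
  by rewrite inE => v0; apply/eqP; have := wP v; rewrite v0.
apply/implyP => v'0; have : v' \in rels w by rewrite inE.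
by have := rels0 w; rewrite relsE !inE => /eqP<-.
Qed.

(** Double counting: for fixed [t], the [w] that have every entry of [t] as a relation form the
    kernel of the evaluated matrix. *)
Lemma sum_card_rels s :
  (\sum_(w : 'cV[K]_m) #|rels w| ^ s =
   \sum_(t : {ffun 'I_s -> V}) #|K| ^ (m - \rank (map_mx ev (tuple_mx t))))%N.
Proof.
transitivity (\sum_(w : 'cV[K]_m) \sum_(t : {ffun 'I_s -> V})
    (if t \in ffun_on (mem (rels w)) then 1 else 0))%N.
  apply: eq_bigr => w _.
  by rewrite -big_mkcond /= sum1_card card_ffun_on card_ord.
rewrite exchange_big /=; apply: eq_bigr => t _.
rewrite -card_cV_ker -sum1_card [RHS]big_mkcond /=; apply: eq_bigr => w _.
congr (if _ then _ else _); rewrite inE [RHS]inE.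
apply/forallP/eqP => [tP|t0 a].
  apply/row_matrixP => a; have := tP a; rewrite inE => /eqP ta0.
  rewrite row_mul row0; apply: etrans ta0; congr (_ *m _).
  by apply/rowP => i; rewrite !mxE.
rewrite inE; have /row_matrixP/(_ a) := t0; rewrite row_mul row0 => ta0.
apply/eqP; apply: etrans ta0; congr (_ *m _); by apply/rowP => i; rewrite !mxE.
Qed.

End Ker.

(* On 1, ..., N, the indicator function of 1. *)
Definition size_indicator (N : nat) : {poly rat} :=
  \prod_(2 <= k < N.+1) ((1 - k%:R)^-1 *: ('X - k%:R%:P)).

Lemma size_indicatorE N k : (0 < k <= N)%N ->
  (size_indicator N).[k%:R] = (k == 1)%:R.
Proof.
case/andP=> k_gt0 k_le; rewrite horner_prod; case: eqVneq => [->|k_neq1].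
  rewrite big_nat big1 // => i /andP[i_gt1 _].
  rewrite hornerZ hornerXsubC mulVf // subr_eq0 (eqr_nat _ 1).
  by rewrite ltn_eqF.
rewrite (bigD1_seq k) ?iota_uniq //=; last first.
  by rewrite mem_index_iota ltnS k_le andbT ltn_neqAle eq_sym k_neq1.
by rewrite hornerZ hornerXsubC subrr mulr0 mul0r.
Qed.

Definition generic_rank s (t : {ffun 'I_s -> V}) : nat :=
  \rank (map_mx (@tofrac {poly F}) (tuple_mx t)).

Lemma generic_rankE (K : fieldType) (ev : {rmorphism {poly F} -> K}) s
    (t : {ffun 'I_s -> V}) :
  injective_below ev (r - m).+1 -> \rank (map_mx ev (tuple_mx t)) = generic_rank t.
Proof.
move=> evP; apply/eqP; rewrite eqn_leq; apply/andP; split.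
  by apply: leq_rank_eval => f nz_f _; rewrite tofrac_eq0.
exact: leq_rank_eval.
Qed.

(** Makes the zero tuple the only one to contribute [X^m] to [count_poly]. *)
Lemma generic_rank_gt0 s (t : {ffun 'I_s -> V}) :
  t != [ffun => 0] -> (0 < generic_rank t)%N.
Proof.
apply: contraNT; rewrite -eqn0Ngt mxrank_eq0 => /eqP/matrixP t0.
apply/eqP/ffunP => a; rewrite ffunE; apply: coef_polys_eq0.
apply/rowP => i; apply/eqP; rewrite [X in _ == X]mxE.
by have := t0 a i; rewrite mxE [RHS]mxE => /eqP; rewrite tofrac_eq0 mxE.
Qed.

(* The evaluation at |K| of the inner sums is the s-th moment of the number of
   relations, and the coefficients of ell turn moments into the indicator. *)
Definition count_poly : {poly rat} :=
  let ell := size_indicator #|{: V}| in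
  \sum_(s < size ell)
    ell`_s *: \sum_(t : {ffun 'I_s -> V}) 'X^(m - generic_rank t).

Lemma count_polyE (K : finFieldType) (ev : {rmorphism {poly F} -> K}) :
  injective_below ev (r - m).+1 ->
  #|[set w | indep ev w]|%:R = count_poly.[#|K|%:R].
Proof.
move=> evP; set ell := size_indicator #|{: V}|.
transitivity (\sum_(w : 'cV[K]_m) ell.[#|rels ev w|%:R]).
  rewrite -sum1_card natr_sum big_mkcond /=; apply: eq_bigr => w _.
  rewrite size_indicatorE ?inE ?indepE; first by case: eqP.
  (* The zero relation is always present, so the number of relations lies in the range where [ell]
     is the indicator of 1. *)
  by rewrite max_card andbT; apply/card_gt0P; exists 0; apply: rels0.
under eq_bigr => w _ do rewrite horner_coef.
rewrite exchange_big horner_sum; apply: eq_bigr => s _ /=.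
rewrite -mulr_sumr hornerZ; congr (_ * _).
transitivity ((\sum_(w : 'cV[K]_m) #|rels ev w| ^ s)%N%:R : rat).
  by rewrite natr_sum; apply: eq_bigr => w _; rewrite natrX.
rewrite sum_card_rels natr_sum horner_sum; apply: eq_bigr => t _.
by rewrite hornerXn natrX generic_rankE.
Qed.

(** At 1 every power of [X] is 1, so the sums collapse to the value of [ell] at the cardinality of
    [V], which exceeds 1. *)
Lemma count_poly1 : (0 < m)%N -> count_poly.[1] = 0.
Proof.
move=> m_gt0; set ell := size_indicator #|{: V}|.
transitivity (ell.[#|{: V}|%:R]).
  rewrite [RHS]horner_coef horner_sum; apply: eq_bigr => s _.
  rewrite hornerZ horner_sum; congr (_ * _).
  transitivity (\sum_(t : {ffun 'I_s -> V}) (1 : rat)).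
    by apply: eq_bigr => t _; rewrite hornerXn expr1n.
  by rewrite sumr_const card_ffun card_ord natrX.
have V_gt1 : (1 < #|{: V}|)%N.
  rewrite card_mx mul1n -[1%N](expn0 #|F|) ltn_exp2l ?finNzRing_gt1 //.
  by rewrite (bigD1 (Ordinal m_gt0)) //= ltn_addr.
by rewrite size_indicatorE ?leqnn ?(ltnW V_gt1) // gtn_eqF.
Qed.

(** The zero tuples contribute [X^m] with total coefficient [ell.[1] = 1]; all other tuples
    contribute lower powers. *)
Lemma count_poly_monic : count_poly \is monic /\ size count_poly = m.+1.
Proof.
set ell := size_indicator #|{: V}|.
have ell1 : ell.[1] = 1.
  rewrite -[1 in LHS]/(1%:R) size_indicatorE //.
  by apply/card_gt0P; exists 0.
pose Q := \sum_(s < size ell) ell`_s *: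
  \sum_(t : {ffun 'I_s -> V} | t != [ffun => 0]) 'X^(m - generic_rank t).
have PE : count_poly = 'X^m + Q.
  rewrite -['X^m in RHS]scale1r -ell1 horner_coef scaler_suml -big_split /=.
  apply: eq_bigr => s _; rewrite expr1n mulr1 -scalerDr; congr (_ *: _).
  rewrite (bigD1 [ffun => 0]) //=; congr ('X^_ + _).
  suff -> : @generic_rank s [ffun => 0] = 0%N by rewrite subn0.
  apply/eqP; rewrite mxrank_eq0; apply/eqP; apply/matrixP => a i.
  by rewrite mxE mxE ffunE raddf0 !mxE rmorph0.
have sizeQ : (size Q < size ('X^m : {poly rat}))%N.
  rewrite size_polyXn ltnS; apply: leq_trans (size_sum _ _ _) _.
  apply/bigmax_leqP => s _; apply: leq_trans (size_scale_leq _ _) _.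
  apply: leq_trans (size_sum _ _ _) _; apply/bigmax_leqP => t /generic_rank_gt0.
  have := rank_leq_col (map_mx (@tofrac {poly F}) (tuple_mx t)).
  by rewrite -/(generic_rank t) size_polyXn; case: (generic_rank t) => // k; lia.
by rewrite PE monicE lead_coefDl // lead_coefXn size_polyDl // size_polyXn.
Qed.

Lemma indep_leq_card (K : finFieldType) (ev : {rmorphism {poly F} -> K}) w :
  indep ev w -> (#|F| ^ r <= #|K|)%N.
Proof.
move=> /forallP wP; rewrite -[r in X in (X <= _)%N]mul1n -card_mx.
pose h (v : V) := (map_mx ev (coef_polys v) *m w) 0 0.
have hB v1 v2 : h (v1 - v2) = h v1 - h v2.
  by rewrite /h raddfB map_mxB mulmxBl [LHS]mxE [X in _ + X = _]mxE.
apply: (leq_card h) => v1 v2 eq12.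
apply/eqP; rewrite -subr_eq0; apply: (implyP (wP _)); apply/eqP.
apply/matrixP => i j; rewrite !ord1 [RHS]mxE.
by rewrite -[LHS]/(h (v1 - v2)) hB eq12 subrr.
Qed.

Lemma card_indep (K : finFieldType) (ev : {rmorphism {poly F} -> K}) :
  (0 < m)%N -> injective_below ev (r - m).+1 ->
  (forall n, (0 < n)%N ->
     exists (K' : finFieldType) (ev' : {rmorphism {poly F} -> K'}),
       #|K'| = (#|F| ^ n)%N /\ injective_below ev' n) ->
  #|[set w | indep ev w]|%:R = (#|K|%:R - 1) *
     \prod_(1 <= i < m) (#|K|%:R - (#|F| ^ (r - m + i))%:R) :> rat.
Proof.
move=> m_gt0 evP ex_field.
have q_gt1 : (1 < #|F|)%N := finNzRing_gt1 F.
have m_le_r : (m <= r)%N.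
  by rewrite -[X in (X <= _)%N]card_ord -sum1_card leq_sum.
pose root_of i : rat := (#|F| ^ (r - m + i))%:R.
pose rs := 1 :: [seq root_of i | i <- index_iota 1 m].
have [monP sizeP] := count_poly_monic.
have Pfact : count_poly = \prod_(z <- rs) ('X - z%:P).
  rewrite [LHS](all_roots_prod_XsubC (rs := rs)) ?(monicP monP) ?scale1r //.
  - by rewrite sizeP /= size_map size_iota subn1 prednK.
  - rewrite /= rootE count_poly1 // eqxx; apply/allP => _ /mapP[i + ->].
    rewrite mem_index_iota => /andP[i_gt0 i_lt_m].
    (* As [i > 0], this field is large enough for [count_polyE]; as [i < m], it has fewer than [q^r]
       elements and so admits no independent vector. *)
    have [|K' [ev' [cardK' ev'P]]] := ex_field (r - m + i)%N; first by lia.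
    rewrite rootE /root_of -cardK' -(count_polyE (ev := ev')); last first.
      by move=> f nz_f le_f; apply: ev'P => //; apply: leq_trans le_f _; lia.
    rewrite pnatr_eq0 cards_eq0; apply/eqP/setP => w; rewrite !inE.
    apply/negP => /indep_leq_card; rewrite cardK' leq_exp2l //; lia.
  - rewrite uniq_rootsE /= map_inj_in_uniq ?iota_uniq ?andbT; last first.
      move=> i j _ _ /eqP; rewrite eqr_nat eqn_exp2l // => /eqP; exact: addnI.
    apply/mapP => -[i]; rewrite mem_index_iota => /andP[i_gt0 _] /eqP.
    rewrite (eqr_nat _ 1) -(expn0 #|F|) eqn_exp2l //; lia.
rewrite count_polyE // Pfact horner_prod big_cons hornerXsubC big_map.
by congr (_ * _); apply: eq_bigr => i _; rewrite hornerXsubC.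
Qed.

End Counting.

(** * Extensions of finite fields *)

Lemma card_finvect (F : finFieldType) (L : fieldExtType F) :
  #|{: finvect_type L}| = (#|F| ^ \dim {: L})%N.
Proof.
by rewrite -(card_vspace (T := finvect_type L)) card_vspacef.
Qed.

Section Generator.

Variables (F : finFieldType) (L : fieldExtType F).
Variable u : {unit finvect_type L}.
Hypothesis u_gen : generator [set: {unit finvect_type L}] u.

Lemma unit_power (x : finvect_type L) : x != 0 -> exists k, x = val u ^+ k.
Proof.
rewrite -unitfE => Ux.
have : FinRing.unit _ Ux \in <[u]>%g by rewrite -(eqP u_gen) inE.
by case/cycleP => k /(congr1 val); rewrite FinRing.val_unitX; exists k.
Qed.

(** Every element of [L] is 0 or a power of [u]. If [f(u) = 0], division by [f] makes it the value
    at [u] of a polynomial of degree below [deg f], so [L] has at most [q^(deg f)] elements. *)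
Lemma injective_below_generator : injective_below (horner_alg (val u)) (\dim {: L}).
Proof.
move=> f nz_f size_f; apply/eqP => fu0.
pose h (v : 'rV[F]_(size f).-1) := horner_alg (val u) (rVpoly v).
have h_surj x : exists v, h v = x.
  have [g <-] : exists g, horner_alg (val u) g = x.
    have [->|/unit_power[k ->]] := eqVneq x 0; first by exists 0; rewrite rmorph0.
    by exists 'X^k; rewrite rmorphXn /= horner_algX.
  exists (poly_rV (g %% f)).
  rewrite /h poly_rV_K; last by rewrite -ltnS prednK ?size_poly_gt0 ?ltn_modp.
  by rewrite [in RHS](divp_eq g f) rmorphD rmorphM /= fu0 mulr0 add0r.
suff : (#|F| ^ \dim {: L} <= #|F| ^ (size f).-1)%N.
  rewrite leq_exp2l ?finNzRing_gt1 //.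
  by rewrite -ltnS prednK ?size_poly_gt0 // ltnNge size_f.
rewrite -card_finvect -[(size f).-1]mul1n -card_mx.
apply: leq_trans (leq_image_card h _).
by apply/subset_leq_card/subsetP => x _; have [v <-] := h_surj x; apply: image_f.
Qed.

End Generator.

Lemma natr_card_finField (F : finFieldType) : #|F|%:R = 0 :> F.
Proof. by rewrite -FinRing.zmodXgE -cardsT expg_cardG ?inE. Qed.

(** The splitting field of [X^(q^n) - X] consists exactly of the [q^n] distinct roots. *)
Lemma exists_extension_degree (F : finFieldType) n : (0 < n)%N ->
  exists L : fieldExtType F, \dim {: L} = n.
Proof.
move=> n_gt0; have q_gt1 := finNzRing_gt1 F.
have qn_gt1 : (1 < #|F| ^ n)%N by rewrite -(expn0 #|F|) ltn_exp2l.
pose f (K : fieldType) : {poly K} := 'X^(#|F| ^ n) - 'X.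
have size_f K : size (f K) = (#|F| ^ n).+1.
  by rewrite size_polyDl size_polyXn // size_polyN size_polyX.
have nz_f K : f K != 0 by rewrite -size_poly_eq0 size_f.
have [L] := FinSplittingFieldFor (nz_f F).
rewrite rmorphB /= map_polyXn map_polyX => -[zs fE zsE]; exists L.
(* The derivative is -1, since [q = 0] in [F]. *)
have sep_f : separable_poly (f L).
  rewrite separable_poly.unlock derivB derivX derivXn -mulr_natr.
  suff -> : (#|F| ^ n)%:R = 0 :> {poly L}.
    rewrite mulr0 sub0r -scaleN1r coprimepZr ?coprimep1 ?oppr_eq0 ?oner_eq0 //.
  rewrite natrX -polyC_natr -[#|F|%:R](rmorph_nat (in_alg L)) natr_card_finField.
  by rewrite rmorph0 polyC0 expr0n gtn_eqF.
have uniq_zs : uniq zs.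
  by rewrite -separable_prod_XsubC -(eqp_separable fE).
have size_zs : size zs = (#|F| ^ n)%N.
  by apply: succn_inj; rewrite -(size_prod_XsubC zs id) -(eqp_size fE) size_f.
have [a _ aE] := finField_galois_generator (sub1v {: L}).
have anE k x : (a ^+ k)%g x = x ^+ (#|F| ^ k).
  elim: k => [|k IHk]; first by rewrite gal_id.
  by rewrite expgSr galM ?memvf // IHk aE ?memvf // dimv1 expn1 expnSr exprM.
(* The [n]-th power of the Frobenius map [a] fixes the roots, which generate [L]; hence it fixes all
   of [L], and every element is a root. *)
have all_zs x : x \in zs.
  have : x \in fixedField [set (a ^+ n)%g].
    have /subvP->// : (fullv <= fixedField [set (a ^+ n)%g])%VS; last exact: memvf.
    rewrite -zsE; apply/Fadjoin_seqP; split; first exact: sub1v.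
    move=> z; rewrite -root_prod_XsubC -(eqp_root fE) rootE !hornerE => z_root.
    apply/(fixedFieldP (memvf _)) => b /set1P->.
    by rewrite anE; apply/eqP; rewrite -subr_eq0.
  move=> /(fixedFieldP (memvf _))/(_ _ (set11 _)); rewrite anE => x_fix.
  by rewrite -root_prod_XsubC -(eqp_root fE) rootE !hornerE x_fix subrr.
apply/eqP; rewrite -(eqn_exp2l _ _ q_gt1) -card_finvect -size_zs; apply/eqP.
rewrite -(card_uniqP (T := finvect_type L) uniq_zs).
by apply: eq_card => x; rewrite inE all_zs.
Qed.

Lemma exists_field_below (F : finFieldType) n : (0 < n)%N ->
  exists (K : finFieldType) (ev : {rmorphism {poly F} -> K}),
    #|K| = (#|F| ^ n)%N /\ injective_below ev n.
Proof.
move=> /(exists_extension_degree F)[L dimL].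
have /cyclicP[u uE] := field_unit_group_cyclic [set: {unit finvect_type L}].
exists (finvect_type L), (horner_alg (val u)); split.
  by rewrite card_finvect dimL.
by rewrite -dimL; apply: injective_below_generator; apply/eqP.
Qed.

(** * Sequences as vectors over the extension field *)

Lemma periodicM (F : finFieldType) m (W : multiseq F m) T k N :
  (forall k : int, W (k + T%:Z) = W k) -> W (k + (N * T)%N%:Z) = W k.
Proof.
move=> WT; elim: N => [|N IHN]; first by rewrite addr0.
by rewrite mulSn addnC PoszD addrA WT IHN.
Qed.

Lemma multiseq_eq (F : finFieldType) m (W1 W2 : multiseq F m) (p : {poly F}) :
  periodic W1 -> periodic W2 -> satisfies W1 p -> satisfies W2 p ->
  (forall j : nat, (j < (size p).-1)%N -> W1 j%:Z = W2 j%:Z) -> W1 = W2.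
Proof.
move=> [T1 T1_gt0 W1T] [T2 T2_gt0 W2T] sat1 sat2 eq_init.
have eq_nat (k : nat) : W1 k%:Z = W2 k%:Z.
  elim/ltn_ind: k => k IHk; have [/eq_init//|le_k] := ltnP k (size p).-1.
  rewrite -(subnK le_k) PoszD sat1 sat2; apply: eq_bigr => i _.
  by rewrite -PoszD IHk // -[X in (_ < X)%N](subnK le_k) ltn_add2l ltn_ord.
(* The recurrence settles only nonnegative indices; adding a common multiple of both periods that is
   at least [|k|] reaches the others. *)
apply: boolp.funext => k; pose N := `|k|%N.
rewrite -(periodicM k (N * T2) W1T) -(periodicM k (N * T1) W2T).
have -> : (N * T1 * T2 = N * T2 * T1)%N by rewrite mulnAC.
suff /gez0_abs <- : 0 <= k + (N * T2 * T1)%N%:Z by exact: eq_nat.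
have : (N <= N * T2 * T1)%N by rewrite -mulnA leq_pmulr // muln_gt0 T2_gt0.
by rewrite /N; lia.
Qed.

Lemma is_min_poly_uniq (F : finFieldType) m (W : multiseq F m) (p1 p2 : {poly F}) :
  is_min_poly W p1 -> is_min_poly W p2 -> p1 = p2.
Proof.
move=> [mon1 min1] [mon2 min2]; apply/eqP; rewrite -eqp_monic // /eqp.
apply/andP; split.
  by apply/(min1 _ mon2)/(min2 _ mon2).
by apply/(min2 _ mon1)/(min1 _ mon1).
Qed.

Section LinearSequences.

Variables (F : finFieldType) (L : fieldExtType F).
Variable u : {unit finvect_type L}.
Hypothesis u_gen : generator [set: {unit finvect_type L}] u.
Variable p : {poly F}.
Hypothesis p_minPoly : map_poly (in_alg L) p = minPoly 1%AS (val u : L).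

Local Notation K := (finvect_type L).
Local Notation n := (\dim {: L}).
Local Notation g := (val u : K).
Local Notation ev := (horner_alg g).

(* Any nonzero linear form would do; this one takes 1 to 1. *)
Definition lin_form (x : K) : F := coord [tuple (1 : K)] ord0 x.

HB.instance Definition _ := GRing.Linear.copy lin_form (coord [tuple (1 : K)] ord0).

Lemma lin_formZ a x : lin_form (a *: x) = a * lin_form x.
Proof. exact: linearZ. Qed.

Lemma lin_form1 : lin_form 1 = 1.
Proof. by rewrite /lin_form (coord_free ord0 ord0) // seq1_free oner_neq0. Qed.

Lemma gen_neq0 : g != 0.
Proof. by rewrite -unitfE; apply: valP. Qed.

Lemma horner_alg_sum d (f : {poly F}) : (size f <= d)%N ->
  ev f = \sum_(i < d) f`_i *: g ^+ i.
Proof.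
move=> size_f; rewrite /horner_alg /horner_morph.
rewrite (horner_coef_wide (n := d)) ?size_map_poly //.
by apply: eq_bigr => i _; rewrite coef_map /= mulr_algl.
Qed.

(** Evaluation is injective on the [q^n] polynomials of degree below [n], hence onto [L]. *)
Lemma horner_alg_onto (x : K) : exists2 f : {poly F}, (size f <= n)%N & ev f = x.
Proof.
pose h (v : 'rV[F]_n) := ev (rVpoly v).
have h_inj : injective h.
  move=> v1 v2 /eqP; rewrite -subr_eq0 -rmorphB -linearB /= => eq0.
  apply: (can_inj rVpolyK); apply/eqP; rewrite -subr_eq0 -linearB.
  apply: contraTT eq0 => nz; apply: (injective_below_generator u_gen) => //.
  by rewrite /rVpoly size_poly.
have /codomP[v ->] : x \in codom h.
  by apply: inj_card_onto => //; rewrite card_mx mul1n card_finvect.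
by exists (rVpoly v) => //; rewrite /rVpoly size_poly.
Qed.

(** If [y] is nonzero, write its inverse as [f(u)] with [deg f < n]; then [1 = f(u) y] is a
    combination of the [u^j y], on which the form vanishes, although it takes 1 to 1. *)
Lemma lin_form_nondeg (y : K) :
  (forall j, (j < n)%N -> lin_form (g ^+ j * y) = 0) -> y = 0.
Proof.
move=> y0; apply/eqP; apply: contraTT isT => nz_y.
have [f size_f fE] := horner_alg_onto y^-1.
have := lin_form1; rewrite -(mulVf nz_y) -fE (horner_alg_sum size_f) mulr_suml.
rewrite raddf_sum big1 /= => [/eqP|i _]; first by rewrite eq_sym oner_eq0.
by rewrite -scalerAl -[LHS]/(lin_form _) lin_formZ y0 // mulr0.
Qed.

Lemma monic_of_minPoly : p \is monic.
Proof. by have := monic_minPoly 1%AS (val u : L); rewrite -p_minPoly map_monic. Qed.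

Lemma horner_alg_eq0 f : ev f = 0 <-> p %| f.
Proof.
have p0 : ev p = 0.
  by apply/rootP; have := root_minPoly 1%AS (val u : L); rewrite -p_minPoly.
split=> [f0|/dvdpP[h ->]]; last by rewrite rmorphM /= p0 mulr0.
rewrite -(dvdp_map (in_alg L)) p_minPoly minPoly_dvdp //; last exact/rootP.
by apply/polyOver1P; exists f.
Qed.

Lemma size_of_minPoly : size p = n.+1.
Proof.
have nz_p : p != 0 := monic_neq0 monic_of_minPoly.
apply/eqP; rewrite eqn_leq; apply/andP; split; last first.
  rewrite ltnNge; apply/negP => /(injective_below_generator u_gen nz_p)/eqP; apply.
  exact/horner_alg_eq0.
have [f size_f fE] := horner_alg_onto (g ^+ n).
have size_Xf : size ('X^n - f) = n.+1.
  by rewrite size_polyDl size_polyXn // size_polyN.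
rewrite -size_Xf dvdp_leq -?size_poly_eq0 ?size_Xf //; apply/horner_alg_eq0.
by rewrite rmorphB rmorphXn /= horner_algX fE subrr.
Qed.

Section Seq.

Variable m : nat.
Implicit Type w : 'cV[K]_m.

Definition lin_seq w : multiseq F m := fun k => \col_i lin_form (g ^ k * w i 0).

Lemma lin_seq_inj : injective lin_seq.
Proof.
move=> w1 w2 eqw; apply/colP => i; apply/eqP; rewrite -subr_eq0; apply/eqP.
apply: lin_form_nondeg => j _; rewrite mulrBr raddfB /=.
have /(congr1 (fun W : multiseq F m => W j%:Z i 0)) := eqw.
by rewrite !mxE => ->; rewrite subrr.
Qed.

(** The defect of the recurrence at [k] in coordinate [i] is the form applied to [u^k f(u) w_i];
    nondegeneracy does the rest. *)
Lemma lin_seq_satisfies w f : f \is monic ->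
  satisfies (lin_seq w) f <-> forall i, ev f * w i 0 = 0.
Proof.
move=> mon_f; set d := (size f).-1.
have sf : size f = d.+1 by rewrite prednK // size_poly_gt0 monic_neq0.
have key k i : lin_form (g ^ k * (ev f * w i 0)) =
   (lin_seq w (k + d%:Z)
    - \sum_(j < d) (- f`_j) *: lin_seq w (k + (j : nat)%:Z)) i 0.
  rewrite [RHS]mxE [X in _ = _ + X]mxE summxE [in X in X + _]mxE.
  rewrite (@horner_alg_sum d.+1) ?sf // big_ord_recr /=.
  have -> : f`_d = 1 by rewrite -(monicP mon_f) lead_coefE.
  rewrite scale1r mulrDl mulrDr raddfD /= addrC mulrA.
  rewrite [_ ^+ d]exprnP -expfzDr ?gen_neq0 //.
  congr (_ + _); rewrite mulr_suml mulr_sumr raddf_sum -sumrN.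
  apply: eq_bigr => j _; rewrite !mxE mulNr opprK /=.
  rewrite -[LHS]/(lin_form _) -scalerAl -scalerAr lin_formZ.
  by rewrite mulrA [_ ^+ j]exprnP -expfzDr ?gen_neq0.
split=> [sat i|f0 k].
  by apply: lin_form_nondeg => j _; rewrite [_ ^+ j]exprnP key sat subrr mxE.
apply/eqP; rewrite -subr_eq0; apply/eqP/colP => i.
by rewrite -key f0 mulr0 raddf0 mxE.
Qed.

Lemma lin_seq_min_poly w : w != 0 -> is_min_poly (lin_seq w) p.
Proof.
move=> nz_w; split=> [|f mon_f]; first exact: monic_of_minPoly.
rewrite lin_seq_satisfies // -horner_alg_eq0.
split=> [f0|-> i]; last by rewrite mul0r.
have [i nz_wi] : exists i, w i 0 != 0.
  apply/existsP; apply: contraNT nz_w => /existsPn w0.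
  by apply/eqP/colP => i; rewrite mxE; apply/eqP/negbNE.
by apply/eqP; have /eqP := f0 i; rewrite mulf_eq0 (negPf nz_wi) orbF.
Qed.

Lemma lin_seq_periodic w : periodic (lin_seq w).
Proof.
exists #[u]%g => [|k]; first exact: order_gt0.
apply/colP => i; rewrite !mxE expfzDr ?gen_neq0 //.
by rewrite -exprnP -FinRing.val_unitX expg_order mulr1.
Qed.

Lemma shift_lin_seq l w : shift l (lin_seq w) = lin_seq (g ^ l *: w).
Proof.
apply: boolp.funext => k; apply/colP => i.
by rewrite !mxE expfzDr ?gen_neq0 // mulrA.
Qed.

(** By nondegeneracy and counting, each block of [n] initial values comes from exactly one element
    of [L], and the recurrence with periodicity fixes the rest. *)
Lemma lin_seq_onto (W : multiseq F m) : periodic W -> satisfies W p ->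
  exists w, W = lin_seq w.
Proof.
move=> perW satW.
pose h (a : K) : 'rV[F]_n := \row_j lin_form (g ^+ j * a).
have h_inj : injective h.
  move=> a b eqh; apply/eqP; rewrite -subr_eq0; apply/eqP/lin_form_nondeg => j lt_j.
  have /rowP/(_ (Ordinal lt_j)) := eqh; rewrite !mxE /= mulrBr raddfB /= => ->.
  by rewrite subrr.
have h_onto (v : 'rV[F]_n) : exists a, h a = v.
  have /codomP[a ->] : v \in codom h; last by exists a.
  by apply: inj_card_onto => //; rewrite card_mx mul1n card_finvect.
have /fin_all_exists[a aE] : forall i,
    exists a, h a = \row_(j < n) W (j : nat)%:Z i 0.
  by move=> i; apply: h_onto.
exists (\col_i a i); apply: (multiseq_eq perW (lin_seq_periodic _) satW).
  apply/lin_seq_satisfies; first exact: monic_of_minPoly.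
  by move=> i; have /horner_alg_eq0-> := dvdpp p; rewrite mul0r.
move=> j; rewrite size_of_minPoly => lt_j; apply/colP => i.
by have /rowP/(_ (Ordinal lt_j)) := aE i; rewrite !mxE => <-.
Qed.

(** By nondegeneracy, a row [v] kills the matrix state exactly when it is a linear relation between
    the [w_i], whatever [k]. *)
Lemma rank_lin_seq w k :
  (\rank (matrix_state (lin_seq w) n k) == m) =
  [forall v : 'rV[F]_m, (\sum_i v 0 i *: w i 0 == 0) ==> (v == 0)].
Proof.
rewrite -[LHS]/(row_free _).
have key (v : 'rV_m) : (v *m matrix_state (lin_seq w) n k == 0) =
    (\sum_i v 0 i *: w i 0 == 0).
  have E (j : 'I_n) : (v *m matrix_state (lin_seq w) n k) 0 j =
      lin_form (g ^+ j * (g ^ k * \sum_i v 0 i *: w i 0)).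
    rewrite mxE !mulr_sumr raddf_sum; apply: eq_bigr => i _.
    rewrite !mxE -!scalerAr -[RHS]/(lin_form _) lin_formZ mulrA.
    rewrite [g ^+ j * _]mulrC exprnP.
    by rewrite -expfzDr ?gen_neq0.
  apply/eqP/eqP => [vM0|v0]; last by apply/rowP => j; rewrite E v0 !mulr0 raddf0 mxE.
  have : g ^ k * (\sum_i v 0 i *: w i 0) = 0.
    apply: lin_form_nondeg => j lt_j; rewrite -(E (Ordinal lt_j)) vM0 mxE //.
  by move/eqP; rewrite mulf_eq0 expfz_eq0 (negPf gen_neq0) andbF => /eqP.
rewrite -kermx_eq0; apply/eqP/forallP => [ker0 v|freew].
  apply/implyP; rewrite -key => vM0; rewrite -submx0 -ker0.
  by apply/sub_kermxP/eqP.
apply/row_matrixP => i; rewrite row0; apply/eqP; apply: (implyP (freew _)).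
by rewrite -key -row_mul mulmx_ker row0.
Qed.

End Seq.

End LinearSequences.

(** * R-extensions and vectors normalised at one coordinate *)

Section Extension.

Variables (F : finFieldType) (L : fieldExtType F).
Variable u : {unit finvect_type L}.
Hypothesis u_gen : generator [set: {unit finvect_type L}] u.
Variable p : {poly F}.
Hypothesis p_minPoly : map_poly (in_alg L) p = minPoly 1%AS (val u : L).
Variables (m : nat) (R : 'I_m -> nat).
Hypothesis R_gt0 : forall i, (0 < R i)%N.

Local Notation K := (finvect_type L).
Local Notation g := (val u : K).
Local Notation ev := (horner_alg g).

Definition extension_vec (w : 'cV[K]_m) : 'cV[K]_(\sum_(i < m) R i) :=
  \mxcol_i \col_(j < R i) (g ^+ j * w i 0).

Lemma extension_lin_seq w :
  extension R (lin_seq u w) = lin_seq u (extension_vec w).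
Proof.
apply: boolp.funext => k; apply/colP => a.
by rewrite !mxE expfzDr ?gen_neq0 // mulrA exprnP.
Qed.

Lemma extension_vec_comb w (v : 'rV[F]_(\sum_(i < m) R i)) :
  \sum_a v 0 a *: extension_vec w a 0 = (map_mx ev (coef_polys v) *m w) 0 0.
Proof.
pose A i := map_mx (in_alg K) (submxrow v i).
transitivity ((\mxrow_i A i *m extension_vec w) 0 0).
  rewrite [RHS]mxE; apply: eq_bigr => a _; rewrite -[LHS]mulr_algl.
  have /matrixP/(_ 0 a) := submxrowK v; rewrite mxE => <-.
  by rewrite [X in _ = X * _]mxE [X in _ = X * _]mxE.
rewrite /extension_vec mul_mxrow_mxcol summxE mxE; apply: eq_bigr => i _.
rewrite [LHS]mxE [in RHS]mxE [in RHS]mxE (@horner_alg_sum _ _ _ (R i)).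
  rewrite mulr_suml; apply: eq_bigr => j _.
  by rewrite coef_rVpoly_ord 2!mxE mulr_algl [X in _ *: X]mxE scalerAl.
by rewrite /rVpoly size_poly.
Qed.

Lemma extension_vec_neq0 w : w != 0 -> extension_vec w != 0.
Proof.
apply: contra_neq => w'0; apply/colP => i; rewrite mxE.
have /mxcolP/(_ i) : extension_vec w = \mxcol_i 0 by rewrite w'0 mxcol0.
rewrite mxcolK => /colP/(_ (Ordinal (R_gt0 i))).
by rewrite !mxE expr0 mul1r.
Qed.

Lemma indepZ w (c : K) : c != 0 -> indep R ev (c *: w) = indep R ev w.
Proof.
move=> nz_c; apply: eq_forallb => v.
by rewrite -scalemxAr scaler_eq0 (negPf nz_c).
Qed.

(** If [w_i = 0], the constant 1 in block [i] is a nontrivial relation; it fits because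
    [R i > 0]. *)
Lemma indep_neq0 w i : indep R ev w -> w i 0 != 0.
Proof.
move=> /forallP indw; apply/eqP => wi0.
pose v : 'rV[F]_(\sum_(i < m) R i) :=
  \mxrow_j poly_rV (if j == i then 1 else 0 : {poly F}).
have vE j : coef_polys v 0 j = if j == i then 1 else 0.
  rewrite mxE mxrowK poly_rV_K //; case: eqP => _; rewrite ?size_poly0 //.
  by rewrite size_poly1.
suff v0 : v = 0.
  have := vE i; rewrite v0 raddf0 mxE eqxx => /eqP.
  by rewrite eq_sym oner_eq0.
apply/eqP; apply: (implyP (indw _)); apply/eqP/matrixP => a b.
rewrite !ord1 !mxE (bigD1 i) //= wi0 mulr0 add0r big1 // => j neq_ji.
by rewrite mxE vE (negPf neq_ji) rmorph0 mul0r.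
Qed.

Lemma lin_seq_has_dimension w : w != 0 ->
  has_dimension (extension R (lin_seq u w)) (\sum_(i < m) R i) <-> indep R ev w.
Proof.
move=> nz_w; rewrite extension_lin_seq.
have minp := lin_seq_min_poly u_gen p_minPoly (extension_vec_neq0 nz_w).
have rankE k : (\rank (matrix_state (lin_seq u (extension_vec w)) (size p).-1 k)
    == \sum_(i < m) R i)%N = indep R ev w.
  rewrite (size_of_minPoly u_gen p_minPoly) rank_lin_seq //.
  apply: eq_forallb => v; congr (_ ==> _); rewrite extension_vec_comb.
  apply/eqP/eqP => [v0|->]; last by rewrite mxE.
  by apply/matrixP => a b; rewrite !ord1 v0 mxE.
split=> [[p' minp' dimE]|indw].
  by rewrite -(rankE 0) (is_min_poly_uniq minp minp') dimE.
by exists p => // k; apply/eqP; rewrite rankE.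
Qed.

(** One representative for each orbit of independent vectors under scaling by nonzero elements of
    [L]. *)
Definition normal_vecs (i : 'I_m) : {set 'cV[K]_m} :=
  [set w | indep R ev w & w i 0 == 1].

Lemma card_normal_vecs i :
  (#|[set w | indep R ev w]| = #|K|.-1 * #|normal_vecs i|)%N.
Proof.
pose scale (x : K * 'cV[K]_m) := x.1 *: x.2.
rewrite -(cardC1 (0 : K)) -[#|predC1 0|]cardsE -cardsX.
rewrite -(card_in_imset (f := scale)).
  apply: eq_card => w; rewrite inE; apply/idP/imsetP => [indw|[[c w']]].
    have nz_wi := indep_neq0 i indw.
    exists (w i 0, (w i 0)^-1 *: w).
      by rewrite !inE /= nz_wi indepZ ?invr_eq0 // indw mxE mulVf /=.
    by rewrite /scale /= scalerA mulfV // scale1r.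
  by rewrite !inE /= => /and3P[nz_c indw' _] ->; rewrite /scale indepZ.
move=> [c1 w1] [c2 w2]; rewrite !inE /scale /=.
case/and3P=> nz_c1 _ /eqP w1i /and3P[_ _ /eqP w2i] eqw.
have eqc : c1 = c2.
  by have /colP/(_ i) := eqw; rewrite !mxE w1i w2i !mulr1.
by congr (_, _) => //; apply: (scalerI nz_c1); rewrite eqw eqc.
Qed.

End Extension.

(** * Counting shift classes *)

(* Imported only now, since it redefines the notations for sets. *)
From mathcomp Require Import boolp classical_sets functions cardinality.

Local Open Scope classical_set_scope.
Local Open Scope ring_scope.

Lemma card_eq_finset (T : finType) (A : {set T}) : ([set` A] #= `I_#|A|)%card.
Proof.
have [->|[x0 x0A]] := set_0Vmem A.
  rewrite cards0 II0 card_eq0; apply/eqP/seteqP; split=> x //=.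
  by rewrite inE.
have -> : [set` A] = nth x0 (enum A) @` `I_#|A|.
  apply/seteqP; split=> [x xA|_ [k k_lt <-]] /=.
    exists (index x (enum A)); last by rewrite nth_index // mem_enum.
    by rewrite /= cardE index_mem mem_enum.
  by rewrite -mem_enum mem_nth // -cardE.
apply: inj_card_eq => j k; rewrite !inE /= => j_lt k_lt /eqP.
by rewrite nth_uniq ?enum_uniq -?cardE // => /eqP.
Qed.

Section Classes.

Variables (F : finFieldType) (L : fieldExtType F).
Variable u : {unit finvect_type L}.
Hypothesis u_gen : generator [set: {unit finvect_type L}]%SET u.
Variable p : {poly F}.
Hypothesis p_minPoly : map_poly (in_alg L) p = minPoly 1%AS (val u : L).
Variables (m : nat) (R : 'I_m -> nat).
Hypothesis R_gt0 : forall i, (0 < R i)%N.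

Local Notation K := (finvect_type L).
Local Notation g := (val u : K).

(** A shift by [l] scales by [u^l], and these powers are all the nonzero scalars because [u] is a
    generator. *)
Lemma shift_class_lin_seq (w1 w2 : 'cV[K]_m) :
  shift_class (lin_seq u w1) = shift_class (lin_seq u w2) <->
  exists2 c, c != 0 & w1 = c *: w2.
Proof.
split=> [eqc|[c nz_c ->]].
  have : shift_class (lin_seq u w1) (lin_seq u w1).
    by exists 0; rewrite shift_lin_seq expr0z scale1r.
  rewrite eqc => -[l]; rewrite shift_lin_seq => /(lin_seq_inj u_gen)->.
  by exists (g ^ l) => //; rewrite expfz_neq0 ?gen_neq0.
have [k ->] := unit_power u_gen nz_c.
apply/seteqP; split=> W [l ->].
  exists (l + k%:Z); rewrite !shift_lin_seq scalerA expfzDr ?gen_neq0 //.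
exists (l - k%:Z).
by rewrite !shift_lin_seq scalerA exprnP -expfzDr ?gen_neq0 // subrK.
Qed.

Lemma extension_classesE (i : 'I_m) :
  extension_classes R p =
  [set shift_class (lin_seq u w) | w in [set` normal_vecs u R i]].
Proof.
have [mon_p size_p] := (monic_of_minPoly p_minPoly, size_of_minPoly u_gen p_minPoly).
apply/seteqP; split=> [_ [W [perW minW dimW] <-]|_ [w + <-]].
  have [w WE] : exists w, W = lin_seq u w.
    apply: (lin_seq_onto u_gen p_minPoly) => //.
    by case: minW => _ /(_ p mon_p)/iffRL; apply.
  have nz_w : w != 0.
    (* The zero sequence satisfies the relation of the polynomial 1, whereas [p] has positive
       degree. *)
    apply/eqP => w0; have /(_ 1 (monic1 _))[+ _] := minW.2.
    rewrite WE w0 => /(_ _)/wrap[].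
      by apply/lin_seq_satisfies; rewrite ?monic1 // => j; rewrite mxE mulr0.
    rewrite dvdp1 size_p eqSS -leqn0 leqNgt.
    by rewrite (adim_gt0 {: L}%AS).
  have indw : indep R (horner_alg g) w.
    by apply/(lin_seq_has_dimension u_gen p_minPoly R_gt0 nz_w); rewrite -WE.
  have nz_wi := indep_neq0 R_gt0 i indw.
  exists ((w i 0)^-1 *: w).
    by rewrite /= inE indepZ ?invr_eq0 // indw mxE mulVf /=.
  by rewrite WE; apply/shift_class_lin_seq; exists (w i 0)^-1; rewrite ?invr_eq0.
rewrite /= inE => /andP[indw _].
have nz_w : w != 0.
  apply: contraTneq indw => ->; apply/negP => /(indep_neq0 R_gt0 i).
  by rewrite mxE eqxx.
exists (lin_seq u w) => //; split; first exact: lin_seq_periodic.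
  exact: lin_seq_min_poly.
exact/(lin_seq_has_dimension u_gen p_minPoly R_gt0 nz_w).
Qed.

Lemma card_extension_classes (i : 'I_m) :
  (extension_classes R p #= `I_#|normal_vecs u R i|)%card.
Proof.
rewrite (extension_classesE i); apply: card_eq_trans (card_eq_finset _).
apply: inj_card_eq => w1 w2; rewrite !inE /= !inE.
case/andP=> _ /eqP w1i /andP[_ /eqP w2i] /shift_class_lin_seq[c _ w1E].
have c1 : c = 1 by have := w1i; rewrite w1E mxE w2i mulr1.
by rewrite w1E c1 scale1r.
Qed.

End Classes.

Theorem theorem3p1 (F : finFieldType) (m n r : nat) (R : 'I_m -> nat)
    (p : {poly F}) (m_gt0 : (0 < m)%N) (R_gt0 : forall i, (0 < R i)%N)
    (r_def : r = (\sum_(i < m) R i)%N)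
    (p_prim : primitive_poly_of_degree n p)
    (* The formula is false when r >= n + m, for in that case the count is 0
       while no factor of the product vanishes. *)
    (r_lt : (r < n + m)%N) :
  exists N : nat,
    (extension_classes R p #= `I_N)%card /\
    N%:Z = \prod_(1 <= i < m) ((#|F| ^ n)%:Z - (#|F| ^ (r - m + i))%:Z).
Proof.
have [L [u [dimL u_gen p_minPoly]]] := p_prim.
pose i0 := Ordinal m_gt0.
exists #|normal_vecs u R i0|; split; first exact: card_extension_classes.
have cardK : #|{: finvect_type L}| = (#|F| ^ n)%N by rewrite card_finvect dimL.
have K_gt1 : (1 < #|{: finvect_type L}|)%N := finNzRing_gt1 (finvect_type L).
have n_gt0 : (0 < n)%N by rewrite -dimL (adim_gt0 {: L}%AS).
(* This is where [r < n + m] enters: it gives [r - m < n]. *)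
have ev_inj : injective_below (horner_alg (val u)) (\sum_i R i - m).+1.
  move=> f nz_f size_f; apply: (injective_below_generator u_gen) => //.
  by rewrite dimL (leq_trans size_f) // -r_def ltn_psubLR // addnC.
have := card_indep R_gt0 m_gt0 ev_inj (exists_field_below F).
(* The factor [q^n - 1] from scaling cancels the one due to the root 1 of [count_poly]. *)
rewrite (card_normal_vecs u R_gt0 i0) natrM -subn1 natrB ?(ltnW K_gt1) //.
move/(mulfI _) => card_N.
apply: (@intr_inj rat); rewrite [LHS]card_N; last first.
  by rewrite subr_eq0 (eqr_nat _ _ 1) gtn_eqF.
rewrite rmorph_prod; apply: eq_bigr => i _.
by rewrite rmorphB /= cardK r_def.
Qed.
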